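(* Let $\Gamma = \mathbb{F}_d$ be the free group on $d \geq 2$ generators, and let $\mu$ be the uniform measure on the generators, i.e. the probability measure on $\Gamma$ that assigns mass $1/(2d)$ to each of the $d$ free generators and each of their inverses. Then there exists an action of $\Gamma$ by homeomorphisms on a locally compact, second countable, $\sigma$-compact Hausdorff space $X$ that admits no nonzero $\mu$-stationary Radon measures.
   Context: Radon measures are non-negative, possibly infinite, Borel measures that are finite on compact sets, with the usual regularity properties (outer regular on Borel sets, inner regular on open sets). For a measure $\lambda$ on $X$ and $g \in \Gamma$, $[g\lambda](E) = \lambda(g^{-1}E)$; $\lambda$ is $\mu$-stationary if $\sum_{g \in \Gamma} \mu(g)\, g\lambda = \lambda$. *)

(* Defs.v *)
From HB Require Import structures.
From mathcomp Require Import all_boot all_order all_algebra.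
From mathcomp Require Import all_classical all_reals all_analysis.

Set Implicit Arguments.
Unset Strict Implicit.
Unset Printing Implicit Defensive.

Import Order.TTheory GRing.Theory Num.Theory.

Local Open Scope classical_set_scope.

(* The letter (i, true) stands for the i-th free generator and (i, false) for
   its inverse. *)
Notation letter d := ('I_d * bool)%type (only parsing).

Definition letter_inv (d : nat) (a : letter d) : letter d := (a.1, ~~ a.2).

Definition reduced (d : nat) (w : seq (letter d)) : bool :=
  sorted (fun a b => b != letter_inv a) w.

(* The free group on d generators, as the set of reduced words. *)
Record free_group (d : nat) : Type :=
  FreeGroup { word : seq (letter d); word_reduced : reduced word }.

HB.instance Definition _ (d : nat) := [isSub for @word d].
HB.instance Definition _ (d : nat) := [Choice of free_group d by <:].

Section FreeGroup.
Variable d : nat.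
Implicit Types (a b : letter d) (u v w : seq (letter d)) (x y : free_group d).

(* The reduced form of a :: w, for w reduced. *)
Definition reduce_cons a w : seq (letter d) :=
  if w is b :: w' then if b == letter_inv a then w' else a :: w else [:: a].

(* The reduced form of u ++ v, for v reduced. *)
Definition reduce_cat u v : seq (letter d) := foldr reduce_cons v u.

Definition word_inv w : seq (letter d) := rev (map (@letter_inv d) w).

Lemma letter_invK : involutive (@letter_inv d).
Proof. by case=> i s; rewrite /letter_inv /= negbK. Qed.

Lemma reduced_cons a w : reduced (a :: w) -> reduced w.
Proof. exact: path_sorted. Qed.

Lemma reduce_cons_reduced a w : reduced w -> reduced (reduce_cons a w).
Proof.
case: w => [//|b w] /=; case: eqP => [_|/eqP ba] bw; first exact: path_sorted bw.
by rewrite /reduced /= ba.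
Qed.

Lemma reduce_cat_reduced u v : reduced v -> reduced (reduce_cat u v).
Proof. by move=> rv; elim: u => //= a u; exact: reduce_cons_reduced. Qed.

Lemma reduce_consK a w :
  reduced w -> reduce_cons a (reduce_cons (letter_inv a) w) = w.
Proof.
case: w => [_|b w bw] /=; first by rewrite eqxx.
rewrite letter_invK; case: eqP => [ba|_] /=; last by rewrite eqxx.
case: w bw => [|c w] /=; first by rewrite ba.
by rewrite ba => /andP[/negPf ->].
Qed.

Lemma reduce_cat_cons a u v : reduced v ->
  reduce_cat (reduce_cons a u) v = reduce_cons a (reduce_cat u v).
Proof.
move=> rv; case: u => [//|b u] /=; case: eqP => [->|//].
by rewrite reduce_consK //; exact: reduce_cat_reduced.
Qed.

Lemma reduce_catA u v w : reduced w ->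
  reduce_cat u (reduce_cat v w) = reduce_cat (reduce_cat u v) w.
Proof.
by move=> rw; elim: u => //= a u ->; rewrite reduce_cat_cons.
Qed.

Lemma reduce_cat0 u : reduced u -> reduce_cat u [::] = u.
Proof.
elim: u => //= a u IHu au; rewrite IHu ?(reduced_cons au)//.
by case: u au {IHu} => //= b u /andP[/negPf ->].
Qed.

Lemma word_invK : involutive word_inv.
Proof.
by move=> u; rewrite /word_inv map_rev revK mapK//; exact: letter_invK.
Qed.

Lemma word_inv_reduced u : reduced u -> reduced (word_inv u).
Proof.
rewrite /reduced /word_inv rev_sorted sorted_map; apply: sub_sorted => a b /=.
by apply: contra_neq; rewrite letter_invK => <-.
Qed.

Lemma reduce_catVw u : reduce_cat (word_inv u) u = [::].
Proof.
elim: u => // a u IHu; rewrite /word_inv /= rev_cons -cats1 /reduce_cat.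
by rewrite foldr_cat /= letter_invK eqxx.
Qed.

Definition free_one : free_group d := @FreeGroup d [::] isT.

Definition free_mul x y : free_group d :=
  FreeGroup (reduce_cat_reduced (word x) (word_reduced y)).

Definition free_inv x : free_group d :=
  FreeGroup (word_inv_reduced (word_reduced x)).

Lemma free_mulA : associative free_mul.
Proof.
by move=> x y z; apply: val_inj; rewrite /= reduce_catA //; exact: word_reduced.
Qed.

Lemma free_mul1 : left_id free_one free_mul.
Proof. by move=> x; exact: val_inj. Qed.

Lemma free_mulr1 : right_id free_one free_mul.
Proof.
by move=> x; apply: val_inj; rewrite /= reduce_cat0//; exact: word_reduced.
Qed.

Lemma free_mulV : left_inverse free_one free_inv free_mul.
Proof. by move=> x; apply: val_inj; exact: reduce_catVw. Qed.

Lemma free_mulrV : right_inverse free_one free_inv free_mul.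
Proof.
by move=> x; apply: val_inj => /=; rewrite -{1}[word x]word_invK reduce_catVw.
Qed.

End FreeGroup.

HB.instance Definition _ (d : nat) := isGroup.Build (free_group d)
  (@free_mulA d) (@free_mul1 d) (@free_mulr1 d) (@free_mulV d) (@free_mulrV d).

Definition free_gen (d : nat) (i : 'I_d) : free_group d :=
  @FreeGroup d [:: (i, true)] isT.

Section UniversalProperty.
Variables (d : nat) (G : groupType) (f : 'I_d -> G).
Local Open Scope group_scope.

Let letter_val (a : letter d) : G := if a.2 then f a.1 else (f a.1)^-1.
Let word_val (w : seq (letter d)) : G := foldr (fun a z => letter_val a * z) 1 w.

Let letter_valV a : letter_val (letter_inv a) = (letter_val a)^-1.
Proof. by case: a => i [] //=; rewrite /letter_val /= invgK. Qed.

Let word_val_cons a w : word_val (reduce_cons a w) = letter_val a * word_val w.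
Proof.
case: w => //= b w; case: eqP => //= ->.
by rewrite letter_valV mulVKg.
Qed.

Let word_valM (x y : free_group d) :
  word_val (word (x * y)) = word_val (word x) * word_val (word y).
Proof.
rewrite /mul /=; elim: (word x) => /= [|a u IHu]; first by rewrite mul1g.
by rewrite word_val_cons IHu mulgA.
Qed.

Lemma free_group_lift : exists2 phi : free_group d -> G,
  {morph phi : x y / x * y} & forall i, phi (free_gen i) = f i.
Proof.
by exists (fun x => word_val (word x)) => // i; rewrite /= mulg1.
Qed.

Lemma free_group_lift_unique (phi psi : free_group d -> G) :
  {morph phi : x y / x * y} -> {morph psi : x y / x * y} ->
  (forall i, phi (free_gen i) = psi (free_gen i)) -> phi =1 psi.
Proof.
move=> phiM psiM eqf.
have m1 (chi : free_group d -> G) : {morph chi : x y / x * y} -> chi 1 = 1.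
  by move=> chiM; apply: (mulgI (chi 1)); rewrite -chiM !mulg1.
have mV (chi : free_group d -> G) : {morph chi : x y / x * y} ->
    forall x, chi x^-1 = (chi x)^-1.
  by move=> chiM x; apply: (mulgI (chi x)); rewrite -chiM !mulgV m1.
case=> w; elim: w => [|[i s] w IHw] rw.
  have -> : FreeGroup rw = 1 by exact: val_inj.
  by rewrite !m1.
have rw' := reduced_cons rw.
have -> : FreeGroup rw =
    (if s then free_gen i else (free_gen i)^-1) * FreeGroup rw'.
  apply: val_inj => /=; have rE : reduce_cons (i, s) w = (i, s) :: w.
    by case: w rw {IHw rw'} => //= b w /andP[/negPf ->].
  by case: s rw rE => rw rE; rewrite -[LHS]rE.
by rewrite phiM psiM IHw; case: s {rw} => //; rewrite ?mV // eqf.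
Qed.

End UniversalProperty.

Local Open Scope ring_scope.

(* The uniform probability measure on the generators and their inverses, given
   by its mass function. *)
Definition uniform_gens (R : realType) (d : nat) (g : free_group d) : R :=
  if [exists i, (g == free_gen i) || (g == (free_gen i)^-1%g)]
  then (2 * d)%:R^-1 else 0.

Lemma uniform_gensE (R : realType) (d : nat) (g : free_group d) :
  uniform_gens R g = if size (word g) == 1%N then (2 * d)%:R^-1 else 0.
Proof.
rewrite /uniform_gens; congr (if _ then _ else _).
apply/existsP/eqP => [[i /orP[]/eqP ->]|] //.
case: g => [[|[i s] [|? ?]] rw] //= _; exists i.
by case: s rw => rw; apply/orP; [left | right]; apply/eqP; exact: val_inj.
Qed.

Lemma uniform_gens_mass (R : realType) (d : nat) : (0 < d)%N ->
  (\esum_(g in [set: free_group d]) (uniform_gens R g)%:E = 1)%E.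
Proof.
move=> d_gt0; pose w1 (a : letter d) := @FreeGroup d [:: a] isT.
have w1_inj : {in [set: letter d] &, injective w1} by move=> a b _ _ [].
have ge0 g : (0 <= (uniform_gens R g)%:E)%E.
  by rewrite lee_fin uniform_gensE; case: ifP.
rewrite (esumID (w1 @` [set: letter d])) // !setTI.
rewrite (@esum1 _ _ (~` _)) ?adde0; last first.
  move=> g gN; rewrite uniform_gensE; case: eqP => // g1; case: gN.
  by case: g g1 => [[|a [|? ?]] rw] //= _; exists a => //; exact: val_inj.
rewrite esum_image // esum_fset //; last exact: finite_finset.
have <- : [set` index_enum (letter d)] = [set: letter d].
  by apply/seteqP; split=> // a _ /=; rewrite mem_index_enum.
rewrite -fsbig_seq ?index_enum_uniq //.
rewrite (eq_bigr (fun=> ((2 * d)%:R^-1)%:E)); last first.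
  by move=> a _; rewrite uniform_gensE.
rewrite sumEFin sumr_const card_prod card_ord card_bool mulnC.
by rewrite -(mulr_natr _^-1) mulVf // pnatr_eq0 -lt0n muln_gt0 d_gt0.
Qed.

Definition sigma_compact (X : topologicalType) : Prop :=
  exists2 K : nat -> set X, forall n, compact (K n) & \bigcup_n K n = [set: X].

Definition homeomorphism (X Y : topologicalType) (f : X -> Y) : Prop :=
  exists f' : Y -> X,
    [/\ cancel f f', cancel f' f, continuous f & continuous f'].

Definition action_by_homeomorphisms (G : groupType) (X : topologicalType)
    (act : G -> X -> X) : Prop :=
  [/\ forall x, act 1%g x = x,
      forall g h x, act (g * h)%g x = act g (act h x) &
      forall g, homeomorphism (act g)].

Definition borel (X : ptopologicalType) : Type := g_sigma_algebraType (@open X).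
HB.instance Definition _ (X : ptopologicalType) := Measurable.on (borel X).

Definition radon (R : realType) (X : ptopologicalType)
    (lambda : {measure set (borel X) -> \bar R}) : Prop :=
  [/\ forall K : set X, compact K -> (lambda K < +oo)%E,
      forall E : set (borel X), measurable E ->
        lambda E =
        ereal_inf [set lambda U | U in [set U : set X | open U /\ E `<=` U]] &
      forall U : set X, open U ->
        lambda U =
        ereal_sup [set lambda K | K in [set K : set X | compact K /\ K `<=` U]]].

Definition translate (R : realType) (G : groupType) (X : ptopologicalType)
    (act : G -> X -> X) (g : G) (lambda : set (borel X) -> \bar R)
    (E : set (borel X)) : \bar R :=
  lambda (act g^-1%g @` E).

Definition stationary (R : realType) (G : groupType) (X : ptopologicalType)
    (act : G -> X -> X) (mu : G -> R)
    (lambda : {measure set (borel X) -> \bar R}) : Prop :=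
  forall E : set (borel X), measurable E ->
    (\esum_(g in [set: G]) ((mu g)%:E * translate act g lambda E) = lambda E)%E.

Definition nonzero_measure (R : realType) (X : ptopologicalType)
    (lambda : {measure set (borel X) -> \bar R}) : Prop :=
  exists2 E : set (borel X), measurable E & lambda E <> 0%E.

(* Main.v *)
(* The space is X = nat * F_d, with F_d acting on the second factor from the
   left.  Sparse finite sets A_1, A_2, ... of F_d are chosen at rapidly
   increasing scales, and X is topologized so that the basic compact open
   neighbourhoods of (n, g) consist of the points (n - j, g a_1 ... a_j) with
   a_l in A_(i_l) and k < i_1 < ... < i_j.  Sparseness makes the factors
   a_1, ..., a_j readable off the product, which gives the Hausdorff property.

   For a stationary Radon measure lambda, h(g) = lambda {(n, g)} is a
   nonnegative harmonic function.  The sum of a harmonic function over a sphere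
   is its value at 1 times the size of the sphere, so by Harnack's inequality
   sparse sets A_i still satisfy sum_(A_i) h >= h(1).  Every neighbourhood of
   (n + 1, 1) contains {n} * A_i for all large i, so its finite mass exceeds any
   multiple of h(1).  Hence h(1) = 0, h = 0 on every level, and lambda = 0
   because X is countable. *)
Require Import Defs.
From HB Require Import structures.
From mathcomp Require Import all_boot all_order all_algebra.
From mathcomp Require Import all_classical all_reals all_analysis.
From mathcomp Require Import zify ring.

Set Implicit Arguments.
Unset Strict Implicit.
Unset Printing Implicit Defensive.

Import Order.TTheory GRing.Theory Num.Theory.

Local Open Scope classical_set_scope.
Local Open Scope ring_scope.

(** * Reduced words and spheres in the free group *)

Section Words.
Variable d : nat.
Implicit Types (c : letter d) (w : seq (letter d)) (g : free_group d).

Definition free_letter c : free_group d := @FreeGroup d [:: c] isT.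

Definition free_word w : free_group d :=
  FreeGroup (@reduce_cat_reduced d w [::] isT).

Definition wlen g := size (word g).

Lemma free_word_cons c w :
  free_word (c :: w) = (free_letter c * free_word w)%g.
Proof. exact: val_inj. Qed.

Lemma word_free_word w : reduced w -> word (free_word w) = w.
Proof. exact: reduce_cat0. Qed.

Lemma free_wordK : cancel (@word d) free_word.
Proof. by move=> g; apply: val_inj; exact: (reduce_cat0 (word_reduced g)). Qed.

Lemma free_letterV c : (free_letter c)^-1%g = free_letter (letter_inv c).
Proof. exact: val_inj. Qed.

Lemma size_reduce_cat u w : (size (reduce_cat u w) <= size u + size w)%N.
Proof.
elim: u => //= c u IHu; apply: leq_trans (_ : (size (reduce_cat u w)).+1 <= _)%N.
  by case: (reduce_cat u w) => //= b v; case: eqP => // _ /=; lia.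
by rewrite addSn ltnS.
Qed.

Lemma wlenM g h : (wlen (g * h)%g <= wlen g + wlen h)%N.
Proof. exact: size_reduce_cat. Qed.

(** Each letter of [u] removes or adds a single letter in front, so [u] is used up before it cancels
    through the longer [v]. *)
Lemma reduce_cat_tail u v w : (size u < size v)%N ->
  exists2 v', reduce_cat u (v ++ w) = v' ++ w & (size v <= size v' + size u)%N.
Proof.
elim: u => [|c u IHu] /= uv; first by exists v; rewrite ?addn0.
have [v' -> sv'] := IHu (ltnW uv); case: v' sv' => [|b v'] /= sv'; first by lia.
case: eqP => _; first by exists v' => //; lia.
by exists (c :: b :: v') => //=; lia.
Qed.

(* The word c^m w, where c is the first letter of w: no cancellation occurs. *)
Definition pad m w := if w is c :: _ then nseq m c ++ w else w.

Lemma letter_inv_neq c : c != letter_inv c.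
Proof. by case: c => i []; apply/eqP => -[]. Qed.

Lemma pad_reduced m w : reduced w -> reduced (pad m w).
Proof.
case: w => [//|c w] rw; elim: m => //= m; rewrite /reduced.
by case: m => [|m] /= ->; rewrite andbT letter_inv_neq.
Qed.

(** Words are extended at the front, to match harmonicity, which multiplies by letters on the
    left. *)
Definition next w := [seq c <- index_enum (letter d : finType) | reduced (c :: w)].

Fixpoint sphere k : seq (seq (letter d)) :=
  if k is k'.+1 then [seq c :: w | w <- sphere k', c <- next w] else [:: [::]].

Lemma sphereP k w : w \in sphere k -> reduced w /\ size w = k.
Proof.
elim: k w => [|k IHk] w /=; first by rewrite inE => /eqP ->.
move=> /allpairsPdep[v [c [/IHk[_ sv]]]]; rewrite mem_filter => /andP[rcv _] ->.
by rewrite /= sv.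
Qed.

Lemma sphere_uniq k : uniq (sphere k).
Proof.
elim: k => //= k IHk; apply: allpairs_uniq_dep => //.
  by move=> w _; rewrite filter_uniq// index_enum_uniq.
by move=> [w c] [w' c'] _ _ /= [-> ->].
Qed.

Lemma next_nil : next [::] = index_enum (letter d : finType).
Proof. by rewrite /next (eq_filter (a2 := predT)) ?filter_predT. Qed.

Lemma next_cons b w : reduced (b :: w) ->
  next (b :: w) = [seq c <- index_enum (letter d : finType) | c != letter_inv b].
Proof.
move=> rw; apply: eq_filter => c /=; move: rw; rewrite /reduced /= => ->.
rewrite andbT; apply/idP/idP; apply: contra_neq => ->; by rewrite letter_invK.
Qed.

Lemma card_letter : #|{: letter d}| = (2 * d)%N.
Proof. by rewrite card_prod card_ord card_bool mulnC. Qed.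

Lemma size_next w : reduced w ->
  size (next w) = if w is [::] then (2 * d)%N else (2 * d).-1.
Proof.
case: w => [_|b w rw]; rewrite -sum1_size.
  by rewrite next_nil -card_letter -sum1_card; exact: eq_bigl.
rewrite next_cons// big_filter sum1dep_card -card_letter -(cardC1 (letter_inv b)).
by apply: eq_card => c; rewrite !inE.
Qed.

End Words.

(** * Harnack inequality and sphere sums of harmonic functions *)

Section Harmonic.
Variables (R : realType) (d : nat).
Hypothesis d_gt1 : (1 < d)%N.

Definition harmonic (h : free_group d -> R) :=
  (forall g, 0 <= h g) /\
  forall g, \sum_(c : letter d) h (free_letter c * g)%g = (2 * d)%:R * h g.

Variable h : free_group d -> R.
Hypothesis harm : harmonic h.

Let h_ge0 g : 0 <= h g. Proof. exact: harm.1. Qed.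
Let n2d_gt0 : 0 < (2 * d)%:R :> R. Proof. by rewrite ltr0n muln_gt0/=; lia. Qed.

(** [h g] is one of the nonnegative terms in the sum of [h] over the neighbours of [c g]. *)
Lemma harnack_letter c g : h g <= (2 * d)%:R * h (free_letter c * g)%g.
Proof.
rewrite -harm.2 (bigD1 (letter_inv c)) //= -free_letterV mulKg lerDl.
by apply: sumr_ge0.
Qed.

Lemma harnack u w :
  h (free_word w) <= (2 * d)%:R ^+ size u * h (free_word (u ++ w)).
Proof.
elim: u => [|c u IHu]; first by rewrite mul1r.
apply: le_trans IHu _; rewrite /= exprSr -mulrA ler_pM2l ?exprn_gt0//.
by rewrite free_word_cons harnack_letter.
Qed.

Lemma harnack1 g : h g <= (2 * d)%:R ^+ wlen g * h 1%g.
Proof.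
have := harnack (word_inv (word g)) (word g).
rewrite free_wordK /word_inv size_rev size_map => /le_trans; apply.
rewrite (_ : free_word _ = 1%g)//; apply: val_inj => /=.
rewrite /reduce_cat foldr_cat -!/(reduce_cat _ _).
by rewrite (reduce_cat0 (word_reduced _)) reduce_catVw.
Qed.

Let H k := \sum_(w <- sphere d k) h (free_word w).

(** The only neighbour of [b :: w] not reached through [next] is [w], obtained by cancelling [b]. *)
Let sum_next b w : reduced (b :: w) ->
  \sum_(c <- next (b :: w)) h (free_word (c :: b :: w)) =
  (2 * d)%:R * h (free_word (b :: w)) - h (free_word w).
Proof.
move=> rw; rewrite next_cons// big_filter -harm.2.
rewrite [X in _ = X - _](bigD1 (letter_inv b)) //=.
rewrite [h (free_letter (letter_inv b) * _)%g](_ : _ = h (free_word w)); last first.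
  by rewrite free_word_cons -free_letterV mulKg.
by rewrite addrAC subrr add0r; apply: eq_bigr => c _; rewrite -free_word_cons.
Qed.

Let HS k : H k.+1 = \sum_(w <- sphere d k) \sum_(c <- next w) h (free_word (c :: w)).
Proof. by rewrite /H /= big_allpairs_dep. Qed.

(** In the sum of [sum_next] over the sphere of radius k+1, each [w] in the sphere of radius k is
    subtracted once per extension. *)
Let HSS k (n : nat) : {in sphere d k, forall w, size (next w) = n} ->
  H k.+2 = (2 * d)%:R * H k.+1 - n%:R * H k.
Proof.
move=> szn; rewrite HS.
rewrite (eq_big_seq (fun w => (2 * d)%:R * h (free_word w) - h (free_word (behead w)))).
  rewrite sumrB -mulr_sumr; congr (_ - _).
  rewrite /= big_allpairs_dep mulr_sumr; apply: eq_big_seq => w /szn <-.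
  by rewrite /= big_const_seq count_predT iter_addr_0 mulr_natl.
by case=> [/sphereP[]|b w /sphereP[rw _]] //; rewrite sum_next.
Qed.

Lemma sphere_sum k : H k.+2 = (2 * d).-1%:R * H k.+1.
Proof.
have dE : (2 * d)%:R = (2 * d).-1%:R + 1 :> R by rewrite natr1 prednK//; lia.
elim: k => [|k IHk].
  (* The empty word has 2d extensions rather than 2d - 1; this is offset by H(1) = 2d H(0). *)
  rewrite (@HSS 0 (2 * d)); last first.
    by move=> w /sphereP[rw]; rewrite size_next//; case: w rw.
  suff -> : H 1 = (2 * d)%:R * H 0 by rewrite dE; ring.
  rewrite HS /H /= !big_seq1 next_nil -harm.2.
  by apply: eq_bigr => c _; rewrite free_word_cons.
rewrite (@HSS k.+1 (2 * d).-1); last first.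
  by move=> w /sphereP[rw]; rewrite size_next//; case: w rw.
by rewrite IHk dE; ring.
Qed.

(** The growth factors 2d and 2d - 1 are both at least 2 because d >= 2. *)
Lemma sphere_sum_ge k : 2 ^+ k * h 1%g <= H k.
Proof.
have H0 : H 0 = h 1%g by rewrite /H /= big_seq1; congr h; exact: val_inj.
have H1 : H 1 = (2 * d)%:R * h 1%g.
  rewrite HS /= big_seq1 next_nil -harm.2; apply: eq_bigr => c _.
  by rewrite free_word_cons; congr (h (_ * _)%g); exact: val_inj.
case: k => [|k]; first by rewrite mul1r H0.
elim: k => [|k IHk]; first by rewrite H1 ler_wpM2r// ler_nat; lia.
rewrite exprS -mulrA sphere_sum ler_pM ?mulr_ge0 ?exprn_ge0// ler_nat; lia.
Qed.

(** By Harnack, padding a word by [m] letters costs at most a factor (2d)^m. *)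
Lemma sum_pad_sphere_ge m k :
  2 ^+ k * h 1%g <= (2 * d)%:R ^+ m * \sum_(w <- sphere d k) h (free_word (pad m w)).
Proof.
apply: le_trans (sphere_sum_ge k) _; rewrite mulr_sumr; apply: ler_sum => w _.
case: w => [|c w]; last by have := harnack (nseq m c) (c :: w); rewrite size_nseq.
by rewrite ler_peMl// exprn_ege1// ler1n; lia.
Qed.

End Harmonic.

(** * Sparse sets recoverable after short left multiplication *)

Section SeparatedSet.
Variable d : nat.
Hypothesis d_gt0 : (0 < d)%N.
Implicit Types (u v a b : free_group d) (r : nat).

(* The long free suffix w makes the set large enough for harmonic sums, while
   the prefix of length r + 1 shields w from left multiplication by elements of
   length at most r, so that w can be recovered. *)
Definition sep_set r : seq (free_group d) :=
  [seq free_word (pad r.+1 w) | w <- sphere d ((2 * d) ^ r.+1)].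

Let radius_lt r : (r < (2 * d) ^ r.+1)%N.
Proof. by apply: leq_ltn_trans (leqnSn r) _; apply: ltn_expl; lia. Qed.

(** [u] can cancel only inside the [r + 1] padding letters, so [w] survives as a suffix. *)
Lemma sep_set_tail r u a : (wlen u <= r)%N -> a \in sep_set r ->
  exists x w, [/\ word (u * a)%g = x ++ w, w \in sphere d ((2 * d) ^ r.+1)
                & a = free_word (pad r.+1 w)].
Proof.
move=> ur /mapP[w ws ->]; have [rw sw] := sphereP ws.
case: w => [|c w] in ws rw sw *; first by have := radius_lt r; rewrite -sw.
have [|v vE _] := @reduce_cat_tail _ (word u) (nseq r.+1 c) (c :: w).
  by rewrite size_nseq ltnS.
exists v, (c :: w); split=> //.
rewrite -vE -[nseq _ _ ++ _]/(pad r.+1 (c :: w)).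
by rewrite -[in RHS](word_free_word (pad_reduced r.+1 rw)).
Qed.

(** Both products end in sphere words of one common length, so these suffixes agree, and they
    determine [a] and [b]. *)
Lemma sep_set_decode r u v a b : (wlen u <= r)%N -> (wlen v <= r)%N ->
  a \in sep_set r -> b \in sep_set r -> (u * a = v * b)%g -> a = b.
Proof.
move=> ur vr /(sep_set_tail ur)[x [w [uaE /sphereP[_ sw] aE]]].
move=> /(sep_set_tail vr)[y [w' [vbE /sphereP[_ sw'] bE]]] /(congr1 (@word d)).
rewrite uaE vbE => /(congr1 (fun s => take (size w) (rev s))).
rewrite !rev_cat -{1}(size_rev w) take_size_cat// sw -sw' -(size_rev w').
by rewrite take_size_cat// aE bE => /(can_inj revK) ->.
Qed.

(** The surviving suffix alone has length (2d)^(r+1) > r. *)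
Lemma sep_set_escape r u a :
  (wlen u <= r)%N -> a \in sep_set r -> (r < wlen (u * a)%g)%N.
Proof.
move=> ur /(sep_set_tail ur)[x [w [uaE /sphereP[_ sw] _]]].
rewrite /wlen uaE size_cat sw; have := radius_lt r; lia.
Qed.

Lemma sep_set_uniq r : uniq (sep_set r).
Proof.
rewrite map_inj_in_uniq ?sphere_uniq// => w w' ws ws' eww'.
have [rw sw] := sphereP ws; have [rw' sw'] := sphereP ws'.
move: eww' => /(congr1 (@word d)); rewrite !word_free_word ?pad_reduced//.
move=> /(congr1 (fun s => take (size w) (rev s))).
have padE (z : seq (letter d)) : exists x, pad r.+1 z = x ++ z.
  by case: z => [|c z]; [exists [::] | exists (nseq r.+1 c)].
have [[x ->] [y ->]] := (padE w, padE w').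
rewrite !rev_cat -{1}(size_rev w) take_size_cat// sw -sw' -(size_rev w').
by rewrite take_size_cat// => /(can_inj revK) ->.
Qed.

Lemma wlen_sep_set r a : a \in sep_set r -> (wlen a <= r.+1 + (2 * d) ^ r.+1)%N.
Proof.
move=> /mapP[w /sphereP[rw sw] ->]; rewrite /wlen word_free_word ?pad_reduced//.
by case: w rw sw => //= c w rw <-; rewrite size_cat size_nseq /=.
Qed.

End SeparatedSet.

(** The sphere radius n = (2d)^(r+1) makes the gain 2^n exceed n, which is exactly the Harnack loss
    from the padding. *)
Lemma sep_set_sum_ge (R : realType) d (h : free_group d -> R) r : (1 < d)%N ->
  harmonic h -> h 1%g <= \sum_(a <- sep_set d r) h a.
Proof.
move=> d1 hh; have h0 := hh.1.
have := sum_pad_sphere_ge d1 hh r.+1 ((2 * d) ^ r.+1).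
rewrite -(big_map (fun w => free_word (pad r.+1 w)) predT) -/(sep_set d r) => hs.
have p0 : 0 < (2 * d)%:R ^+ r.+1 :> R by rewrite exprn_gt0// ltr0n; lia.
rewrite -(ler_pM2l p0); apply: le_trans hs.
rewrite ler_wpM2r// -!natrX ler_nat; exact/ltnW/ltn_expl.
Qed.

(** * Spikes at increasing scales and rigidity of walks *)

Section Spikes.
Variable d : nat.

(* radius i bounds the length of any product of elements of spikes of strictly
   increasing indices below i. *)
Fixpoint radius i : nat :=
  if i is j.+1 then
    (radius j + ((radius j).+1 + (2 * d) ^ (radius j).+1)).+1
  else 0.

Definition spike i : seq (free_group d) := sep_set d (radius i).

Lemma leq_radius : {homo radius : i j / (i <= j)%N}.
Proof.
apply: homo_leq => [//|? ? ?|i]; first exact: leq_trans.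
by rewrite /=; apply/leqW/leq_addr.
Qed.

Lemma radius_ge i : (i <= radius i)%N.
Proof. by elim: i => //= i IHi; rewrite ltnS (leq_trans IHi)// leq_addr. Qed.

Lemma wlenM_spike i g a :
  (wlen g <= radius i)%N -> a \in spike i -> (wlen (g * a)%g <= radius i.+1)%N.
Proof.
move=> gi ai; apply: leq_trans (wlenM _ _) _; apply: leqW.
exact: leq_add gi (wlen_sep_set ai).
Qed.

(** The data k < i_1 < ... < i_j with a_l in A_(i_l) behind a point of a basic neighbourhood. *)
Definition chain k (t : seq (nat * free_group d)) :=
  path ltn k (map fst t) && all (fun p => p.2 \in spike p.1) t.

Definition walk g (t : seq (nat * free_group d)) := foldl (fun x p => x * p.2)%g g t.

Lemma walkM h g t : walk (h * g)%g t = (h * walk g t)%g.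
Proof. by elim: t g => //= p t IHt g; rewrite -IHt mulgA. Qed.

Lemma chain_cat k s t :
  chain k (s ++ t) = chain k s && chain (last k (map fst s)) t.
Proof.
by rewrite /chain map_cat cat_path all_cat; case: path; case: all; rewrite ?andbF.
Qed.

Lemma chain_sub j k t : (j <= k)%N -> chain k t -> chain j t.
Proof.
move=> jk /andP[pt at_]; rewrite /chain at_ andbT.
by case: t pt {at_} => //= p t /andP[kp ->]; rewrite andbT (leq_ltn_trans jk).
Qed.

Lemma last_chain k t : chain k t -> (k <= last k (map fst t))%N.
Proof.
elim: t k => //= -[i a] t IHt k /andP[/= /andP[ki pt] /andP[_ at_]].
by rewrite (leq_trans (ltnW ki))// IHt//; apply/andP.
Qed.

Lemma chain_rcons k t i a : chain k (rcons t (i, a)) =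
  [&& chain k t, (last k (map fst t) < i)%N & a \in spike i].
Proof. by rewrite -cats1 chain_cat /chain /= !andbT. Qed.

Lemma wlen_walk k g t j : (wlen g <= radius k)%N -> chain k t ->
  (last k (map fst t) < j)%N -> (wlen (walk g t) <= radius j)%N.
Proof.
move=> gk; elim/last_ind: t j => [j _ /= kj|t [i a] IHt j].
  by rewrite (leq_trans gk)// leq_radius// ltnW.
rewrite chain_rcons map_rcons last_rcons => /and3P[ct li ai] ij.
rewrite /walk foldl_rcons; apply: leq_trans (leq_radius ij).
exact: wlenM_spike (IHt _ ct li) ai.
Qed.

(** Induction on the last factors. If one chain is empty or has the smaller last index, its walk
    ends too close to 1 to meet the other, whose last factor escapes. If the last indices agree,
    decoding makes the last factors equal and they cancel. *)
Lemma walk_inj k u v s t : (0 < d)%N ->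
  (wlen u <= radius k)%N -> (wlen v <= radius k)%N -> chain k s -> chain k t ->
  walk u s = walk v t -> size s = size t /\ u = v.
Proof.
move=> d0 uk vk; elim/last_ind: s t => [|s [i a] IHs] t;
  elim/last_ind: t => [|t [j b] _] //.
- rewrite chain_rcons /walk foldl_rcons => _ /and3P[ct lj bj] /= uE.
  have := sep_set_escape d0 (wlen_walk vk ct lj) bj.
  rewrite -/(walk _ _) in uE *; rewrite -uE ltnNge (leq_trans uk)// leq_radius//.
  by rewrite (leq_trans (last_chain ct))// ltnW.
- rewrite chain_rcons /walk foldl_rcons => /and3P[cs li ai] _ /= vE.
  have := sep_set_escape d0 (wlen_walk uk cs li) ai.
  rewrite -/(walk _ _) in vE *; rewrite vE ltnNge (leq_trans vk)// leq_radius//.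
  by rewrite (leq_trans (last_chain cs))// ltnW.
rewrite !chain_rcons /walk !foldl_rcons -!/(walk _ _) /=.
move=> /and3P[cs li ai] /and3P[ct lj bj] E.
have ui := wlen_walk uk cs li; have vj := wlen_walk vk ct lj.
have [ij|ji|ij] := ltngtP i j.
- have := sep_set_escape d0 vj bj.
  by rewrite -E ltnNge (leq_trans (wlenM_spike ui ai))// leq_radius.
- have := sep_set_escape d0 ui ai.
  by rewrite E ltnNge (leq_trans (wlenM_spike vj bj))// leq_radius.
rewrite -ij in vj bj; have ab := sep_set_decode d0 ui vj ai bj E.
rewrite ab in E; have [st ->] := IHs t cs ct (@mulIg _ b _ _ E).
by rewrite !size_rcons st.
Qed.

End Spikes.

(** * The space: topology, compactness, separation and action *)

Definition tower (d : nat) : Type := (nat * free_group d)%type.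

HB.instance Definition _ d := Countable.copy (free_group d) (can_type (@free_wordK d)).
HB.instance Definition _ d := Countable.on (tower d).
HB.instance Definition _ d := isPointed.Build (tower d) (0%N, 1%g).

Section Tower.
Variable d : nat.
Implicit Types (x y z : tower d) (k : nat) (g h : free_group d).

(** Each factor descends one level. The additive form avoids truncated subtraction, which would
    admit walks longer than [x.1]. *)
Definition horn k x : set (tower d) :=
  [set y | exists t, [/\ chain k t, (y.1 + size t)%N = x.1 & y.2 = walk x.2 t]].

Definition tower_open (V : set (tower d)) :=
  forall x, V x -> exists k, horn k x `<=` V.

Lemma horn_self k x : horn k x x.
Proof. by exists [::]; rewrite addn0. Qed.

Lemma horn_sub j k x : (j <= k)%N -> horn k x `<=` horn j x.
Proof. by move=> jk y [t [ct]]; exists t; split=> //; exact: chain_sub ct. Qed.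

(** A chain whose indices exceed the last index of another can be appended to it. *)
Lemma horn_open k x : tower_open (horn k x).
Proof.
move=> y [t [ct ty yE]]; exists (last k (map fst t)) => z [s [cs sz zE]].
exists (t ++ s); split; first by rewrite chain_cat ct.
  by rewrite size_cat -ty -sz addnA addnAC.
by rewrite zE yE /walk foldl_cat.
Qed.

Fact tower_openT : tower_open setT.
Proof. by move=> x _; exists 0%N. Qed.

Fact tower_openI : setI_closed tower_open.
Proof.
move=> U V oU oV x [/oU[i iU] /oV[j jV]]; exists (maxn i j) => y hy.
by split; [apply: iU | apply: jV]; apply: horn_sub hy; rewrite ?leq_maxl ?leq_maxr.
Qed.

Fact tower_open_bigU (I : Type) (f : I -> set (tower d)) :
  (forall i, tower_open (f i)) -> tower_open (\bigcup_i f i).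
Proof.
by move=> of_ x [i _ /of_[k kf]]; exists k => y /kf fy; exists i.
Qed.

HB.instance Definition _ := isOpenTopological.Build (tower d)
  tower_openT tower_openI tower_open_bigU.

Lemma open_horn k x : open (horn k x). Proof. exact: horn_open. Qed.

Lemma nbhs_horn k x : nbhs x (horn k x).
Proof. by apply: open_nbhs_nbhs; split; [exact: open_horn | exact: horn_self]. Qed.

Lemma nbhs_hornP x (V : set (tower d)) : nbhs x V -> exists k, horn k x `<=` V.
Proof.
rewrite nbhsE => -[U [oU Ux] UV]; have [k kU] := (oU : tower_open U) x Ux.
by exists k; exact: subset_trans UV.
Qed.

Definition branches j k : seq (nat * free_group d) :=
  [seq (i, a) | i <- iota j.+1 (k - j), a <- spike d i].

(** Sort chains by their first index: beyond [k] they stay in the smaller horn; otherwise the first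
    factor has finitely many values and the rest lies in a horn one level down. *)
Lemma horn_split j k n g : horn j (n.+1, g) `<=` horn k (n.+1, g) `|`
  \big[setU/set0]_(p <- branches j k)
    horn p.1 (n, (g * p.2)%g).
Proof.
move=> y [[|[i a] t] [ct ty yE]].
  by left; exists [::].
move: ct; rewrite -cat1s chain_cat /= {1}/chain /= !andbT => /andP[/andP[ji ai] ct].
have [ik|ki] := leqP i k; last first.
  left; exists ((i, a) :: t); split=> //.
  by rewrite -cat1s chain_cat /= {1}/chain /= ki ai.
right; rewrite -bigcup_seq; exists (i, a) => /=.
  apply/allpairsPdep; exists i, a; split=> //.
  by rewrite mem_iota ji /=; lia.
by exists t; split=> //; apply/eqP; rewrite -eqSS -[X in _ == X]ty /= addnS.
Qed.

(** Induction on the level: away from a smaller horn at its apex, a horn is covered by finitely many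
    horns one level down. *)
Lemma horn_compact k x : compact (horn k x).
Proof.
case: x => n; elim: n k => [|n IHn] k g.
  suff -> : horn k (0%N, g) = [set (0%N, g)] by exact: compact_set1.
  apply/seteqP; split=> [[m h] [[|p t] [_]]|_ ->]; last exact: horn_self.
    by rewrite /= addn0 => -> ->.
  by rewrite /= addnS.
move=> F PF Fk; have [Fx|] := pselect (cluster F (n.+1, g)).
  by exists (n.+1, g); split=> //; exact: horn_self.
move=> /existsNP[B] /existsNP[V] /not_implyP[FB] /not_implyP[].
move=> /nbhs_hornP[k' kV] BV.
(* Some [B] in [F] misses [horn k'] at the apex, so [B] meets [horn k] only inside [C], and [C]
   belongs to [F]. *)
pose C := \big[setU/set0]_(p <- branches k k')
    horn p.1 (n, (g * p.2)%g).
have cC : compact C by apply: bigsetU_compact => p _; exact: IHn.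
have Ck : C `<=` horn k (n.+1, g).
  rewrite /C -bigcup_seq => y [[i a] /allpairsPdep[i' [a' [+ ai [-> ->]]]]] /=.
  rewrite mem_iota => /andP[ki _] [t [ct ty yE]]; exists ((i', a') :: t); split=> //.
    by rewrite -cat1s chain_cat /= {1}/chain /= ki ai.
  by rewrite /= addnS ty.
have FC : F C.
  apply: filterS (filterI FB Fk) => y [By /(@horn_split _ k')[ky|//]].
  by exfalso; apply: BV; exists y; split=> //; exact: kV.
by have [y [Cy Fy]] := cC F PF FC; exists y; split=> //; exact: Ck.
Qed.

Lemma tower_hausdorff : (0 < d)%N -> hausdorff_space (tower d).
Proof.
(* Since [radius k >= k], this [k] lets [walk_inj] apply to a common point of the two horns; equal
   step counts then give equal levels. *)
move=> d0 [n g] [m h] /= cl; pose k := maxn (wlen g) (wlen h).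
have [[l z] []] := cl _ _ (nbhs_horn k (n, g)) (nbhs_horn k (m, h)).
move=> [s [cs /= <- zE]] [t [ct /= <- E]]; rewrite zE in E.
have gk : (wlen g <= radius d k)%N by rewrite (leq_trans _ (radius_ge d k))// leq_maxl.
have hk : (wlen h <= radius d k)%N by rewrite (leq_trans _ (radius_ge d k))// leq_maxr.
by have [-> ->] := walk_inj d0 gk hk cs ct E.
Qed.

Lemma horn_closed k x : (0 < d)%N -> closed (horn k x).
Proof.
by move=> d0; apply: compact_closed (@horn_compact k x); exact: tower_hausdorff.
Qed.

Lemma tower_locally_compact : (0 < d)%N -> locally_compact [set: tower d].
Proof.
move=> d0 x _; rewrite withinET; exists (horn 0 x); first exact: nbhs_horn.
by split; [exact: horn_compact | exact: horn_closed].
Qed.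

Lemma tower_second_countable : @second_countable (tower d).
Proof.
exists (range (fun p : nat * tower d => horn p.1 p.2)).
  exact: card_le_trans (card_image_le _ _) (countableP _).
split=> [_ [p _ <-]|x V /nbhs_hornP[k kV]]; first exact: open_horn.
by exists (horn k x) => //; split; [exists (k, x) | exact: horn_self].
Qed.

Lemma tower_sigma_compact : sigma_compact (tower d).
Proof.
exists (fun n => if unpickle n is Some x then [set x] else set0) => [n|].
  by case: unpickle => [x|]; [exact: compact_set1 | exact: compact0].
by apply/seteqP; split=> // x _; exists (pickle x); rewrite //= pickleK.
Qed.

Definition tower_act g x : tower d := (x.1, (g * x.2)%g).

(** Walks multiply on the right and the action on the left, so they commute. *)
Lemma tower_act_horn g k x y : horn k x y -> horn k (tower_act g x) (tower_act g y).
Proof. by move=> [t [ct ty yE]]; exists t; split=> //=; rewrite yE walkM. Qed.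

Lemma tower_act_continuous g : continuous (tower_act g).
Proof.
apply/continuousP => V oV.
suff: tower_open (tower_act g @^-1` V) by [].
move=> x /= Vgx; have [k kV] := (oV : tower_open V) _ Vgx.
by exists k => y /(tower_act_horn g) /kV.
Qed.

Lemma tower_actK g : cancel (tower_act g) (tower_act g^-1%g).
Proof. by case=> n h; rewrite /tower_act /= mulKg. Qed.

Lemma tower_action : action_by_homeomorphisms (G := free_group d) tower_act.
Proof.
split=> [[n h]|g1 g2 [n h]|g]; rewrite /tower_act /= ?mul1g ?mulgA//.
exists (tower_act g^-1%g); split; first exact: tower_actK.
- by move=> x; have := tower_actK g^-1%g x; rewrite invgK.
- exact: tower_act_continuous.
- exact: tower_act_continuous.
Qed.

End Tower.

(** * Borel sets and averages over the letters *)

Lemma borel_open (X : ptopologicalType) (U : set X) :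
  open U -> measurable (U : set (borel X)).
Proof. by move=> oU; exact: sub_sigma_algebra. Qed.

Lemma borel_closed (X : ptopologicalType) (F : set X) :
  closed F -> measurable (F : set (borel X)).
Proof.
move=> cF; rewrite -[F]setCK; apply: measurableC; apply: borel_open.
exact: closed_openC.
Qed.

Lemma esum_uniform_gens (R : realType) d (F : free_group d -> \bar R) :
  (forall g, (0 <= F g)%E) ->
  (\esum_(g in [set: free_group d]) ((uniform_gens R g)%:E * F g) =
   \sum_(c : letter d) (((2 * d)%:R^-1)%:E * F (free_letter c)))%E.
Proof.
move=> F0.
have fl_inj : {in [set: letter d] &, injective (@free_letter d)}.
  by move=> a b _ _ [].
have ge0 g : (0 <= (uniform_gens R g)%:E * F g)%E.
  by rewrite mule_ge0// lee_fin uniform_gensE; case: ifP.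
rewrite (esumID (@free_letter d @` [set: letter d])) // !setTI.
rewrite (@esum1 _ _ (~` _)) ?adde0; last first.
  move=> g gN; rewrite uniform_gensE; case: eqP => [g1|]; last by rewrite mul0e.
  case: gN; case: g g1 => [[|a [|? ?]] rw] //= _; exists a => //; exact: val_inj.
rewrite esum_image // esum_fset //; last exact: finite_finset.
have <- : [set` index_enum (letter d : finType)] = [set: letter d].
  by apply/seteqP; split=> // a _ /=; rewrite mem_index_enum.
rewrite -fsbig_seq ?index_enum_uniq //.
by apply: eq_bigr => c _; rewrite uniform_gensE.
Qed.

(** * Vanishing of stationary Radon measures *)

Section StationaryTower.
Variables (R : realType) (d : nat).
Hypothesis d_gt1 : (1 < d)%N.
Variable lambda : {measure set (borel (tower d)) -> \bar R}.
Hypothesis radon_lambda : radon lambda.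
Hypothesis stat_lambda :
  stationary (G := free_group d) (@tower_act d) (@uniform_gens R d) lambda.

Let d_gt0 : (0 < d)%N. Proof. exact: ltnW. Qed.

Let mass n (g : free_group d) : R := fine (lambda [set (n, g)]).

Let measurable_point (x : tower d) : measurable ([set x] : set (borel (tower d))).
Proof.
apply: borel_closed; apply: compact_closed (@compact_set1 _ x).
exact: tower_hausdorff.
Qed.

Let massE n g : lambda [set (n, g)] = (mass n g)%:E.
Proof.
rewrite /mass fineK// ge0_fin_numE//; have [+ _ _] := radon_lambda; apply.
exact: (@compact_set1 (tower d) (n, g)).
Qed.

Let mass_harmonic n : harmonic (mass n).
Proof.
split=> [g|g]; first by rewrite -lee_fin -massE.
have := stat_lambda (measurable_point (n, g)).
rewrite esum_uniform_gens; last by move=> k; exact: measure_ge0.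
rewrite massE -ge0_sume_distrr; last by move=> c _; exact: measure_ge0.
under eq_bigr do rewrite /translate image_set1 /tower_act /= free_letterV massE.
rewrite sumEFin -EFinM => -[/(canRL (mulVKf _)) <-]; last by rewrite pnatr_eq0; lia.
(* Translation by [c] evaluates the mass at the inverse letter; inversion permutes the letters. *)
by rewrite [LHS](reindex_inj (inv_inj (@letter_invK d))).
Qed.

Let sum_mass_le n (A : seq (free_group d)) (K : set (tower d)) :
  uniq A -> measurable (K : set (borel (tower d))) ->
  (forall a, a \in A -> K (n, a)) -> ((\sum_(a <- A) mass n a)%:E <= lambda K)%E.
Proof.
move=> uA mK AK.
suff <- : lambda (\big[setU/set0]_(a <- A) [set (n, a)]) = (\sum_(a <- A) mass n a)%:E.
  apply: le_measure; rewrite ?inE//.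
    by apply: bigsetU_measurable => a _; exact: measurable_point.
  by rewrite -bigcup_seq => x [a /= aA ->]; exact: AK.
elim: A uA {AK} => [|a A IHA] /=; first by rewrite !big_nil measure0.
move=> /andP[aA uA]; rewrite !big_cons measureU//; last 2 first.
- by apply: bigsetU_measurable => b _; exact: measurable_point.
- apply/seteqP; split=> // x [->]; rewrite -bigcup_seq => -[b /= bA [ab]].
  by rewrite ab bA in aA.
by rewrite EFinD -massE; congr (_ + _)%E; exact: IHA.
Qed.

(** Indices start at 1 because chains in [horn 0] have indices above 0. *)
Let spikes m := flatten [seq spike d i | i <- iota 1 m].

(** Spikes are disjoint: elements of [spike j] have length at most [radius j.+1], while those of a
    later spike exceed its own radius. *)
Let spikes_uniq m : uniq (spikes m).
Proof.
rewrite /spikes; elim: m 1%N => //= m IHm j; rewrite cat_uniq sep_set_uniq IHm andbT/=.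
apply/hasPn => a /flatten_mapP[i]; rewrite mem_iota => /andP[ji _] ai.
apply/negP => aj.
have := @sep_set_escape d d_gt0 (radius d i) 1%g a (leq0n _) ai.
have := @wlenM_spike d j 1%g a (leq0n _) aj.
move=> /leq_trans/(_ (leq_radius d ji)); rewrite leqNgt => /negP h /h; exact.
Qed.

Let mass1 n : mass n 1%g = 0.
Proof.
have h0 := (mass_harmonic n).1.
have le m : m%:R * mass n 1%g <= fine (lambda (horn 0 (n.+1, 1%g))).
  apply: (@le_trans _ _ (\sum_(a <- spikes m) mass n a)); last first.
    rewrite -lee_fin fineK; last first.
      rewrite ge0_fin_numE//; have [+ _ _] := radon_lambda; apply.
      exact: horn_compact.
    apply: sum_mass_le; first exact: spikes_uniq.
      by apply: borel_closed; exact: horn_closed.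
    move=> a /flatten_mapP[i]; rewrite mem_iota => /andP[i0 _] ai.
    exists [:: (i, a)]; rewrite /= addn1 mul1g; split=> //.
    by rewrite /chain /= i0 ai.
  (* The factor [m] becomes a count of indices, so that the bound is checked spike by spike. *)
  rewrite /spikes big_flatten big_map -[m in m%:R](size_iota 1 m) mulr_natl.
  rewrite -iter_addr_0 -(count_predT (iota 1 m)) -big_const_seq.
  by apply: ler_sum => i _; exact: sep_set_sum_ge.
apply/eqP; rewrite eq_le h0 andbT leNgt; apply/negP => m0.
set M := fine _ in le.
have := le (Num.truncn (M / mass n 1%g)).+1.
rewrite -ler_pdivlMr// leNgt => /negP; apply.
exact: truncnS_gt.
Qed.

Lemma stationary_tower_eq0 (E : set (borel (tower d))) :
  measurable E -> lambda E = 0%E.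
Proof.
move=> mE; apply/eqP; rewrite eq_le measure_ge0 andbT.
pose P k : set (borel (tower d)) :=
  if (unpickle k : option (tower d)) is Some x then [set x] else set0.
have mP k : measurable (P k).
  by rewrite /P; case: unpickle => [x|]; [exact: measurable_point | exact: measurable0].
have EP : E `<=` \bigcup_k P k.
  by move=> x _; exists (pickle (x : tower d)); rewrite // /P pickleK.
have := @measure_sigma_subadditive _ R (borel (tower d)) lambda E P mP mE EP.
move=> /le_trans; apply.
rewrite eseries0// => k _ _; rewrite /P; case: unpickle => [[n g]|]; last exact: measure0.
rewrite massE; congr _%:E; apply/eqP; rewrite eq_le (mass_harmonic n).1 andbT.
(* Harnack carries the vanishing at 1 to every [g]. *)
by rewrite (le_trans (harnack1 d_gt1 (mass_harmonic n) g))// mass1 mulr0.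
Qed.

End StationaryTower.

Theorem proposition1p4 (R : realType) (d : nat) (hd : (2 <= d)%N) :
  exists (X : ptopologicalType) (act : free_group d -> X -> X),
    [/\ locally_compact [set: X], @second_countable X, sigma_compact X,
        hausdorff_space X & action_by_homeomorphisms act] /\
    ~ exists lambda : {measure set (borel X) -> \bar R},
        [/\ radon lambda, stationary act (@uniform_gens R d) lambda
          & nonzero_measure lambda].
Proof.
have d0 : (0 < d)%N by exact: ltnW.
exists (tower d), (@tower_act d); split.
  split; [exact: tower_locally_compact | exact: tower_second_countable
    | exact: tower_sigma_compact | exact: tower_hausdorff | exact: tower_action].
move=> [lambda [rl sl [E mE]]]; apply; exact: stationary_tower_eq0.
Qed.
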